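(* Let $n\geq 2$, let $R_+>R_->0$ and let $\psi>0$ be a constant. There exists a sequence of strictly convex, radially symmetric solutions $u^{(k)}=u^{(k)}(r)$, $r=|x|$, of $$u_{rr}\Big(\frac{u_r}r\Big)^{n-1}=\psi^n$$ on $B_{R_+}\setminus\overline{B_{R_-}}\subset\mathbb{R}^n$ for which the second normal derivative $u^{(k)}_{\nu\nu}$ on the inner boundary $\Gamma^-=\partial B_{R_-}$ grows without bound as $k\to\infty$.
   Context: $B_R\subset\mathbb{R}^n$ is the open ball of radius $R$ centred at the origin; $\nu=x/|x|$ is the unit normal on $\Gamma^-$ pointing into $B_{R_+}\setminus\overline{B_{R_-}}$, so $u_{\nu\nu}=u_{rr}(R_-)$ for radial $u$. The displayed equation is the form taken by $\det[D^2u]=\psi^n$ for radial $u\in C^2(B_{R_+}\setminus \overline{B_{R_-}})$ up to the boundary. A function is strictly convex if its Hessian is positive definite. *)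

(* Defs.v *)
From mathcomp Require Import all_boot all_order all_algebra.
From mathcomp Require Import all_classical all_reals all_analysis.

Set Implicit Arguments.
Unset Strict Implicit.
Unset Printing Implicit Defensive.
Import Order.TTheory GRing.Theory Num.Theory.
Import numFieldNormedType.Exports.

Local Open Scope classical_set_scope.
Local Open Scope ring_scope.

(* The library norm `|x| on 'rV[R]_n is the sup norm; the topology it induces
   is the usual one. *)
Definition enorm (R : realType) (n : nat) (x : 'rV[R]_n) : R :=
  Num.sqrt (\sum_(i < n) x 0 i ^+ 2).

Definition eball (R : realType) (n : nat) (r : R) : set 'rV[R]_n :=
  [set x | enorm x < r].

Definition annulus (R : realType) (n : nat) (Rm Rp : R) : set 'rV[R]_n :=
  @eball R n Rp `\` closure (@eball R n Rm).

Definition boundary (T : topologicalType) (A : set T) : set T :=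
  closure A `\` interior A.

Definition partial (R : realType) (n : nat) (i : 'I_n) (u : 'rV[R]_n -> R) :
  'rV[R]_n -> R := fun x => 'D_(delta_mx 0 i) u x.

Definition hessian (R : realType) (n : nat) (u : 'rV[R]_n -> R)
  (x : 'rV[R]_n) : 'M[R]_n := \matrix_(i, j) partial i (partial j u) x.

Definition quad_form (R : realType) (n : nat) (A : 'M[R]_n) (v : 'rV[R]_n) : R :=
  (v *m A *m v^T) 0 0.

Definition pos_def (R : realType) (n : nat) (A : 'M[R]_n) : Prop :=
  forall v : 'rV[R]_n, v != 0 -> 0 < quad_form A v.

Definition strictly_convex_on (R : realType) (n : nat) (O : set 'rV[R]_n)
  (u : 'rV[R]_n -> R) : Prop := forall x, O x -> pos_def (hessian u x).

Definition extends_to_closure (R : realType) (n : nat) (O : set 'rV[R]_n)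
  (f : 'rV[R]_n -> R) : Prop :=
  exists2 g : 'rV[R]_n -> R,
    {within closure O, continuous g} & forall x, O x -> g x = f x.

(* C^2 up to the boundary of the open set O: u is C^2 in O, and the partial
   derivatives of order at most 2 extend continuously to closure O. *)
Definition C2_up_to_boundary (R : realType) (n : nat) (O : set 'rV[R]_n)
  (u : 'rV[R]_n -> R) : Prop :=
  [/\ {within closure O, continuous u},
      forall i : 'I_n,
        (forall x, O x -> derivable u x (delta_mx 0 i)) /\
        extends_to_closure O (partial i u)
    & forall i j : 'I_n,
        (forall x, O x -> derivable (partial j u) x (delta_mx 0 i)) /\
        extends_to_closure O (partial i (partial j u))].

(* Radial symmetry, with radial profile f, so that u_r = f' and u_rr = f''.
   Values of u outside closure (annulus Rm Rp) are irrelevant. *)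
Definition radial_solution (R : realType) (n : nat) (Rm Rp psi : R)
  (u : 'rV[R]_n -> R) : Prop :=
  exists f : R -> R,
    (forall x, closure (@annulus R n Rm Rp) x -> u x = f (enorm x)) /\
    (forall r, Rm < r < Rp -> derive1n 2 f r * (derive1 f r / r) ^+ (n - 1) = psi ^+ n).

Definition radial_normal (R : realType) (n : nat) (x : 'rV[R]_n) : 'rV[R]_n :=
  (enorm x)^-1 *: x.

(* At a boundary point x of O, the value of u_nunu is that of the continuous
   extension of D^2 u, i.e. the limit taken from within O. *)
Definition second_normal_derivative (R : realType) (n : nat)
  (O : set 'rV[R]_n) (u : 'rV[R]_n -> R) (x : 'rV[R]_n) : R :=
  lim (quad_form (hessian u y) (radial_normal x) @[y --> within O (nbhs x)]).

(* Main.v *)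
Require Import Defs.
From mathcomp Require Import all_boot all_order all_algebra.
From mathcomp Require Import all_classical all_reals all_analysis ring.
Import Order.TTheory GRing.Theory Num.Theory.
Import numFieldNormedType.Exports.

Local Open Scope classical_set_scope.
Local Open Scope ring_scope.

(**
  The radial equation is the exact derivative (u_r ^ n)' = (psi ^ n r ^ n)', so
  u_r ^ n = psi ^ n (r ^ n - rho ^ n) with rho a free constant.  For rho < Rm this
  is smooth up to the inner sphere, and
  u_rr = psi ^ n r ^ (n - 1) / u_r ^ (n - 1) blows up at r = Rm as rho tends to Rm.
  Working with s = |x|^2 and H(s) = u_r / r, the Hessian is
  H(s) I + 2 H'(s) x^T x, with H > 0 and H' >= 0.
*)

(** * Roots, and the Euclidean norm with its square *)

Lemma continuous_at_of_is_derive {R : realType} {f : R -> R} {x df : R} :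
  is_derive x 1 f df -> {for x, continuous f}.
Proof. by case=> /derivable1_diffP/differentiable_continuous. Qed.

Lemma powR_inv_exprn {R : realType} (n : nat) (x : R) :
  (0 < n)%N -> 0 <= x -> (x `^ n%:R^-1) ^+ n = x.
Proof.
move=> n0 x0; rewrite -powR_mulrn ?powR_ge0// -powRrM.
by rewrite mulVf ?pnatr_eq0 -?lt0n// powRr1.
Qed.

Definition sqnorm {R : realType} {n : nat} (x : 'rV[R]_n) : R :=
  \sum_(i < n) x 0 i ^+ 2.

Lemma continuous_sqnorm {R : realType} {n : nat} :
  continuous (@sqnorm R n).
Proof.
move=> x; rewrite /sqnorm.
apply: cvg_big => [||i _]; [exact: add_continuous|exact: nbhs_filter|].
apply: (@continuous_comp _ _ _ (fun y : 'rV[R]_n => y 0 i) (fun t => t ^+ 2)).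
  exact: coord_continuous.
exact: exprn_continuous.
Qed.

Lemma continuous_enorm {R : realType} {n : nat} : continuous (@enorm R n).
Proof.
move=> x; apply: (@continuous_comp _ _ _ (@sqnorm R n) Num.sqrt).
  exact: continuous_sqnorm.
exact: sqrt_continuous.
Qed.

Lemma enorm_ge0 {R : realType} {n : nat} (x : 'rV[R]_n) : 0 <= enorm x.
Proof. exact: sqrtr_ge0. Qed.

Lemma enorm_sqr {R : realType} {n : nat} (x : 'rV[R]_n) :
  enorm x ^+ 2 = sqnorm x.
Proof. by rewrite sqr_sqrtr// sumr_ge0// => i _; rewrite sqr_ge0. Qed.

Lemma enormZ {R : realType} {n : nat} (a : R) (x : 'rV[R]_n) :
  enorm (a *: x) = `|a| * enorm x.
Proof.
rewrite /enorm -sqrtr_sqr -sqrtrM ?sqr_ge0//; congr Num.sqrt.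
by rewrite mulr_sumr; apply: eq_bigr => i _; rewrite mxE exprMn.
Qed.

Lemma sqnorm_gt0 {R : realType} {n : nat} {x : 'rV[R]_n} :
  x != 0 -> 0 < sqnorm x.
Proof.
move=> x0; rewrite lt_neqAle sumr_ge0 ?andbT//; last first.
  by move=> i _; rewrite sqr_ge0.
apply: contraNneq x0 => /esym/eqP.
rewrite psumr_eq0; last by move=> i _; rewrite sqr_ge0.
move=> /allP xi; apply/eqP/rowP => i; rewrite mxE.
by have := xi i; rewrite mem_index_enum sqrf_eq0 => /(_ erefl)/eqP.
Qed.

(** * Topology of balls and of the annulus *)

Section annulus.
Context {R : realType} {n : nat} {Rm Rp : R}.

Lemma open_eball (r : R) : open (@eball R n r).
Proof.
apply: (@open_comp _ _ (@enorm R n) [set y | y < r]) => [x _|].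
  exact: continuous_enorm.
exact: open_lt.
Qed.

Lemma closure_eball (r : R) :
  closure (@eball R n r) `<=` [set x | enorm x <= r].
Proof.
have cl : closed [set x : 'rV[R]_n | enorm x <= r].
  apply: (@closed_comp _ _ (@enorm R n) [set y | y <= r]) => [x _|].
    exact: continuous_enorm.
  exact: closed_le.
rewrite [X in _ `<=` X]((closure_id _).1 cl).
by apply: closureS => x; exact: ltW.
Qed.

Lemma boundary_eball (r : R) (x : 'rV[R]_n) :
  boundary (eball r) x -> enorm x = r.
Proof.
move=> [/closure_eball/= xr]; rewrite ((interior_id _).1 (open_eball r)).
by move=> /negP; rewrite -leNgt => rx; apply/eqP; rewrite eq_le xr.
Qed.

(** The set on the right is closed and contains the annulus. The bound keeps the radial formulas
    valid up to the inner sphere. *)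
Lemma closure_annulus :
  closure (@annulus R n Rm Rp) `<=` [set x | Rm <= enorm x].
Proof.
have cl : closed [set x : 'rV[R]_n | Rm <= enorm x].
  apply: (@closed_comp _ _ (@enorm R n) [set y | Rm <= y]) => [x _|].
    exact: continuous_enorm.
  exact: closed_ge.
rewrite [X in _ `<=` X]((closure_id _).1 cl); apply: closureS => x [_ xR].
by rewrite /= leNgt; apply/negP => xR'; apply: xR; exact: subset_closure.
Qed.

(** The dilations [t *: x] with [t] slightly above 1 lie in the annulus and tend to [x]. Limits
    taken from within the annulus thus make sense at [x]. *)
Lemma inner_sphere_annulus {x : 'rV[R]_n} : 0 < Rm -> Rm < Rp ->
  enorm x = Rm -> closure (annulus Rm Rp) x.
Proof.
move=> Rm0 RmRp xR B Bx.
have cvgx : t *: x @[t --> (1 : R)^'+] --> x.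
  rewrite -[X in _ --> X]scale1r; apply: cvg_at_right_filter.
  by apply: cvgZl; exact: cvg_id.
have h : \forall t \near (1 : R)^'+, [/\ B (t *: x), 1 < t & t < Rp / Rm].
  near=> t; split; near: t.
  - exact: cvgx.
  - exact: nbhs_right_gt.
  - by apply: nbhs_right_lt; rewrite ltr_pdivlMr// mul1r.
have [t [Bt t1 tR]] := filter_ex h.
have tx : enorm (t *: x) = t * Rm.
  by rewrite enormZ gtr0_norm ?xR// (lt_trans _ t1).
exists (t *: x); split=> //; split; first by rewrite /eball/= tx -ltr_pdivlMr.
by move=> /closure_eball/=; rewrite tx ger_pMl// leNgt t1.
Unshelve. all: by end_near. Qed.
End annulus.

(** * Directional derivatives by restriction to lines *)

Lemma is_derive_line {R : realType} {V W : normedModType R} (f : V -> W)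
    (x v : V) (df : W) :
  is_derive (0 : R) 1 (fun h => f (h *: v + x)) df -> is_derive x v f df.
Proof.
move=> [d1 d2]; split; first by apply/(derivable1P f x v).
rewrite -d2 /derive; set g1 := fun h => h^-1 *: _; set g2 := fun h => h^-1 *: _.
suff -> : g1 = g2 by [].
by apply/funext => h; rewrite /g1 /g2/= scale0r add0r addr0 [h%:A]mulr1.
Qed.

Lemma sqnorm_line {R : realType} {n : nat} (x : 'rV[R]_n) (i : 'I_n) (h : R) :
  sqnorm (h *: delta_mx 0 i + x) = sqnorm x + 2 * x 0 i * h + h ^+ 2.
Proof.
rewrite /sqnorm (bigD1 i)//= [in RHS](bigD1 i)//= !mxE !eqxx mulr1.
rewrite (eq_bigr (fun j => x 0 j ^+ 2)).
  by ring.
by move=> j ji; rewrite !mxE (negbTE ji) andbF mulr0 add0r.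
Qed.

(** On a coordinate line [sqnorm] is a quadratic polynomial with derivative [2 * x 0 i] at 0, so the
    one-variable chain rule is enough. *)
Lemma is_derive_sqnorm {R : realType} {n : nat} {F : R -> R} {dF : R}
    {x : 'rV[R]_n} (i : 'I_n) :
  is_derive (sqnorm x) 1 F dF ->
  is_derive x (delta_mx 0 i) (F \o sqnorm) (2 * dF * x 0 i).
Proof.
move=> dF'; apply: is_derive_line.
have -> : (fun h : R => (F \o @sqnorm R n) (h *: delta_mx 0 i + x)) =
    F \o (fun h => sqnorm x + 2 * x 0 i * h + h ^+ 2).
  by apply/funext => h; rewrite /= sqnorm_line.
have dg : is_derive (0 : R) 1 (fun h => sqnorm x + 2 * x 0 i * h + h ^+ 2)
    (2 * x 0 i).
  by apply: is_derive_eq; rewrite -![_ *: _]/(_ * _); ring.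
rewrite -[2 * dF]mulrC -mulrA; apply: is_derive1_comp dg.
by rewrite mulr0 expr0n/= !addr0.
Qed.

Lemma is_derive_coord {R : realType} {n : nat} (x : 'rV[R]_n) (i j : 'I_n) :
  is_derive x (delta_mx 0 i) (fun y : 'rV[R]_n => y 0 j) (i == j)%:R.
Proof.
apply: is_derive_line.
have -> : (fun h : R => (h *: delta_mx 0 i + x : 'rV[R]_n) 0 j) =
    (fun h => h * (i == j)%:R + x 0 j).
  by apply/funext => h; rewrite !mxE eqxx eq_sym.
by apply: is_derive_eq; rewrite -![_ *: _]/(_ * _); ring.
Qed.

(** * Calculus of functions of [sqnorm x] *)

Section radial.
Context {R : realType} {n : nat} {s0 : R} {F H H' : R -> R}.
(** The factor 1/2 cancels the 2 in the gradient of [sqnorm], so that the gradient of [u] is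
    [H (sqnorm x) *: x]. *)
Hypothesis dF : forall s, s0 < s -> is_derive s 1 F (H s / 2).
Hypothesis dH : forall s, s0 < s -> is_derive s 1 H (H' s).
Hypothesis cH' : forall s, s0 < s -> {for s, continuous H'}.

Local Notation u := (F \o @sqnorm R n).
Local Notation U := [set x : 'rV[R]_n | s0 < sqnorm x].

Lemma near_sqnorm_gt {x : 'rV[R]_n} : U x -> \forall y \near x, U y.
Proof.
move=> Ux; apply: open_nbhs_nbhs; split=> //.
apply: (@open_comp _ _ (@sqnorm R n) [set s | s0 < s]) => [y _|].
  exact: continuous_sqnorm.
exact: open_gt.
Qed.

Lemma is_derive_radial {x : 'rV[R]_n} (i : 'I_n) : U x ->
  is_derive x (delta_mx 0 i) u (H (sqnorm x) * x 0 i).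
Proof.
move=> Ux; have := is_derive_sqnorm i (dF _ Ux).
by rewrite mulrCA divff ?mulr1.
Qed.

Lemma partial_radial {x : 'rV[R]_n} (i : 'I_n) : U x ->
  partial i u x = H (sqnorm x) * x 0 i.
Proof. by move=> Ux; have [] := is_derive_radial i Ux. Qed.

Lemma is_derive_partial_radial {x : 'rV[R]_n} (i j : 'I_n) : U x ->
  is_derive x (delta_mx 0 i) (partial j u)
    (2 * H' (sqnorm x) * x 0 i * x 0 j + H (sqnorm x) * (i == j)%:R).
Proof.
(* The first partial is known only on [U]; since [U] is open, it may be replaced near [x] by its
   formula before differentiating again. *)
move=> Ux; apply: (@near_eq_is_derive _ _ _
    ((H \o @sqnorm R n) * (fun y : 'rV[R]_n => y 0 j))).
  by apply: filterS (near_sqnorm_gt Ux) => y Uy; rewrite partial_radial.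
have dh := is_derive_sqnorm i (dH _ Ux); have dj := is_derive_coord x i j.
by apply: is_derive_eq; rewrite -![_ *: _]/(_ * _)/=; ring.
Qed.

Lemma partial2_radial {x : 'rV[R]_n} (i j : 'I_n) : U x ->
  partial i (partial j u) x =
    2 * H' (sqnorm x) * x 0 i * x 0 j + H (sqnorm x) * (i == j)%:R.
Proof. by move=> Ux; have [] := is_derive_partial_radial i j Ux. Qed.

Lemma continuous_H_sqnorm {x : 'rV[R]_n} :
  U x -> {for x, continuous (H \o @sqnorm R n)}.
Proof.
move=> Ux; apply: continuous_comp; first exact: continuous_sqnorm.
exact/continuous_at_of_is_derive/dH.
Qed.

Lemma continuous_H'_sqnorm {x : 'rV[R]_n} :
  U x -> {for x, continuous (H' \o @sqnorm R n)}.
Proof.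
by move=> Ux; apply: continuous_comp; [exact: continuous_sqnorm|exact: cH'].
Qed.

(** The required extensions are the explicit formulas themselves, which stay continuous on [U] and
    hence on [closure O]. *)
Lemma C2_radial (O : set 'rV[R]_n) :
  closure O `<=` U -> C2_up_to_boundary O u.
Proof.
move=> clO; have OU x : O x -> U x by move=> Ox; exact/clO/subset_closure.
split=> [|i|i j].
- apply: continuous_in_subspaceT => x /[!inE] /clO Ux.
  apply: continuous_comp; first exact: continuous_sqnorm.
  exact/continuous_at_of_is_derive/dF.
- split=> [x /OU Ux|]; first by have [] := is_derive_radial i Ux.
  exists (fun x => H (sqnorm x) * x 0 i); last first.
    by move=> x /OU Ux; rewrite partial_radial.
  apply: continuous_in_subspaceT => x /[!inE] /clO Ux.
  by apply: continuousM; [exact: continuous_H_sqnorm|exact: coord_continuous].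
- split=> [x /OU Ux|]; first by have [] := is_derive_partial_radial i j Ux.
  exists (fun x => 2 * H' (sqnorm x) * x 0 i * x 0 j +
      H (sqnorm x) * (i == j)%:R); last first.
    by move=> x /OU Ux; rewrite partial2_radial.
  apply: continuous_in_subspaceT => x /[!inE] /clO Ux.
  have cst (c : R) : {for x, continuous (fun _ : 'rV[R]_n => c)}.
    exact: cst_continuous.
  have crd k : {for x, continuous (fun y : 'rV[R]_n => y 0 k)}.
    exact: coord_continuous.
  exact: (continuousD
    (continuousM (continuousM
      (continuousM (cst 2) (continuous_H'_sqnorm Ux)) (crd i)) (crd j))
    (continuousM (continuous_H_sqnorm Ux) (cst (i == j)%:R))).
Qed.

Lemma quad_form_hessian_radial (x v : 'rV[R]_n) : U x ->
  quad_form (hessian u x) v =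
    H (sqnorm x) * sqnorm v + 2 * H' (sqnorm x) * (\sum_i x 0 i * v 0 i) ^+ 2.
Proof.
move=> Ux; have -> : hessian u x =
    (2 * H' (sqnorm x)) *: (x^T *m x) + (H (sqnorm x))%:M.
  apply/matrixP => i j; rewrite !mxE partial2_radial// big_ord1 !mxE.
  by rewrite mulr_natr -!mulrA.
rewrite /quad_form mulmxDr mulmxDl mxE addrC mul_mx_scalar -scalemxAl.
rewrite -scalemxAr -scalemxAl [X in X + _]mxE [X in _ + X]mxE.
congr (_ * _ + _ * _).
  by rewrite mxE; apply: eq_bigr => i _; rewrite mxE expr2.
rewrite mulmxA -(mulmxA (v *m x^T)) mxE big_ord1 expr2 !mxE; congr (_ * _).
  by apply: eq_bigr => i _; rewrite mxE mulrC.
by apply: eq_bigr => i _; rewrite mxE.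
Qed.

Lemma pos_def_hessian_radial {x : 'rV[R]_n} : U x ->
  0 < H (sqnorm x) -> 0 <= H' (sqnorm x) -> pos_def (hessian u x).
Proof.
move=> Ux H0 H'0 v v0; rewrite quad_form_hessian_radial//.
by rewrite ltr_wpDr ?mulr_gt0 ?sqnorm_gt0// mulr_ge0 ?sqr_ge0// mulr_ge0.
Qed.

(** The quadratic form of the Hessian is given near [x] by a continuous expression, so the limit is
    its value at [x], where [nu] has norm 1 and the inner product of [x] and [nu] is [enorm x]. *)
Lemma second_normal_derivative_radial (O : set 'rV[R]_n) {x : 'rV[R]_n} :
  O `<=` U -> closure O x -> U x -> x != 0 ->
  second_normal_derivative O u x =
    H (sqnorm x) + 2 * sqnorm x * H' (sqnorm x).
Proof.
(* Properness of the filter makes the limit unique, which [cvg_lim] requires. *)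
move=> OU clx Ux x0; have px := within_nbhs_proper clx.
have q0 := sqnorm_gt0 x0; have e2 := enorm_sqr x.
have e0 : enorm x != 0 by rewrite -sqrf_eq0 e2 gt_eqF.
set nu := radial_normal x.
have nu1 : sqnorm nu = 1.
  by rewrite -enorm_sqr enormZ ger0_norm ?invr_ge0 ?enorm_ge0// mulVf// expr1n.
have xnu : (\sum_i x 0 i * nu 0 i) ^+ 2 = sqnorm x.
  have -> : \sum_i x 0 i * nu 0 i = (enorm x)^-1 * sqnorm x.
    by rewrite mulr_sumr; apply: eq_bigr => i _; rewrite mxE mulrCA -expr2.
  by rewrite -e2 expr2 mulKf.
have -> : H (sqnorm x) + 2 * sqnorm x * H' (sqnorm x) =
    H (sqnorm x) * sqnorm nu + 2 * H' (sqnorm x) * (\sum_i x 0 i * nu 0 i) ^+ 2.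
  by rewrite nu1 xnu; ring.
apply: cvg_lim => //.
(* The direction [nu] stays frozen at the boundary point while [y] varies, hence the inner product
   of [y] and [nu] rather than [enorm y]. *)
apply: (@cvg_trans _ (H (sqnorm y) * sqnorm nu +
    2 * H' (sqnorm y) * (\sum_i y 0 i * nu 0 i) ^+ 2
    @[y --> within O (nbhs x)])).
  apply: near_eq_cvg; apply: filterS (withinT _ _) => y /OU Uy.
  by rewrite quad_form_hessian_radial.
have cst (c : R) : {for x, continuous (fun _ : 'rV[R]_n => c)}.
  exact: cst_continuous.
have cdot : {for x, continuous (fun y : 'rV[R]_n => \sum_i y 0 i * nu 0 i)}.
  apply: cvg_big => [||i _]; [exact: add_continuous|exact: nbhs_filter|].
  have ci : {for x, continuous (fun y : 'rV[R]_n => y 0 i)}.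
    exact: coord_continuous.
  exact: (continuousM ci (cst (nu 0 i))).
have cdot2 : {for x, continuous (fun y : 'rV[R]_n =>
    (\sum_i y 0 i * nu 0 i) ^+ 2)}.
  exact: (@continuous_comp _ _ _ _ (fun t : R => t ^+ 2) _ cdot
    (@exprn_continuous _ 2 _)).
apply: cvg_within_filter.
exact: (continuousD
  (continuousM (continuous_H_sqnorm Ux) (cst (sqnorm nu)))
  (continuousM (continuousM (cst 2) (continuous_H'_sqnorm Ux)) cdot2)).
Qed.

End radial.

(** * One-variable tools: antiderivatives and the explicit profile *)

(** The integral from [b] serves for all [x] at once. The margin between [a] and [b] gives
    continuity at the lower endpoint too. *)
Lemma antiderivative_ray (R : realType) (f : R -> R) (a b : R) : a < b ->
  (forall x, a < x -> {for x, continuous f}) ->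
  exists F : R -> R, forall x, b < x -> is_derive x 1 F (f x).
Proof.
move=> ab cf.
exists (fun x => \int[lebesgue_measure]_(t in [set` `[b, x]]) f t).
move=> x bx.
(* Integrating up to [x + 1] makes [x] an interior point for the fundamental theorem of calculus. *)
have int : lebesgue_measure.-integrable `[b, x + 1] (EFin \o f).
  apply: continuous_compact_integrable; first exact: segment_compact.
  apply: continuous_in_subspaceT => y; rewrite inE/= in_itv/= => /andP[by_ _].
  exact/cf/(lt_le_trans ab).
have [||dF F'] := continuous_FTC1_closed _ int bx; first by rewrite ltrDl.
  exact/cf/(lt_trans ab).
by apply: DeriveDef => //; rewrite -derive1E.
Qed.

(* The function H of the header: with s = r ^ 2, u_r ^ n = psi ^ n (r ^ n - rho ^ n)
   reads u_r / r = slope s. *)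
Definition slope {R : realType} (n : nat) (psi rho s : R) : R :=
  psi * (1 - rho ^+ n * s `^ (- (n%:R / 2))) `^ n%:R^-1.

(* The derivative of slope, in the form read off the differential equation
   [(H + 2 s H') H ^ (n - 1) = psi ^ n]. *)
Definition slope' {R : realType} (n : nat) (psi rho s : R) : R :=
  (psi ^+ n - slope n psi rho s ^+ n) / (2 * s * slope n psi rho s ^+ n.-1).

Lemma powR_half_sqr {R : realType} (n : nat) (r : R) : 0 < r ->
  (r ^+ 2) `^ (- (n%:R / 2)) = r ^- n.
Proof.
move=> r0; rewrite -powR_mulrn ?ltW// -powRrM.
by rewrite -powR_invn ?ltW//; congr (_ `^ _); rewrite mulrN mulrC divfK.
Qed.

(** * Sign, differential equation and regularity of the explicit slope *)

Section slope.
Context {R : realType} (n : nat) (psi rho : R).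
Hypotheses (n0 : (0 < n)%N) (psi0 : 0 < psi) (rho0 : 0 < rho).

Let s_gt0 {s : R} : rho ^+ 2 < s -> 0 < s.
Proof. by apply: lt_trans; rewrite exprn_gt0. Qed.

Let W (s : R) := 1 - rho ^+ n * s `^ (- (n%:R / 2)).

(** Writing [rho ^+ n] as the power n/2 of [rho ^+ 2] reduces this to the strict monotonicity of
    that power. *)
Let W_gt0 {s : R} : rho ^+ 2 < s -> 0 < W s.
Proof.
move=> hs; have s0 := s_gt0 hs; rewrite /W subr_gt0.
rewrite powRN ltr_pdivrMr ?powR_gt0// mul1r.
have -> : rho ^+ n = (rho ^+ 2) `^ (n%:R / 2).
  by rewrite -[n%:R / 2]opprK powRN powR_half_sqr// invrK.
by apply: gt0_ltr_powR; rewrite ?nnegrE ?divr_gt0 ?ltr0n ?ltW// exprn_gt0.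
Qed.

Lemma slope_gt0 {s : R} : rho ^+ 2 < s -> 0 < slope n psi rho s.
Proof. by move=> hs; rewrite mulr_gt0// powR_gt0// W_gt0. Qed.

Lemma slope_expn {s : R} : rho ^+ 2 < s ->
  slope n psi rho s ^+ n = psi ^+ n * (1 - rho ^+ n * s `^ (- (n%:R / 2))).
Proof.
move=> hs; rewrite exprMn; congr (_ * _).
by rewrite powR_inv_exprn// ltW// W_gt0.
Qed.

(** By [slope_expn] the numerator is psi^n rho^n s^(-n/2). *)
Lemma slope'_ge0 {s : R} : rho ^+ 2 < s -> 0 <= slope' n psi rho s.
Proof.
move=> hs; have s0 := s_gt0 hs.
apply: divr_ge0; last by rewrite !mulr_ge0 ?exprn_ge0 ?ltW// slope_gt0.
rewrite slope_expn// -[X in X - _]mulr1 -mulrBr opprB addrCA subrr addr0.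
by rewrite !mulr_ge0 ?powR_ge0// exprn_ge0// ltW.
Qed.

(** This is the radial equation, with u_rr = H + 2 s H' and u_r / r = H. It is pure algebra, because
    [slope'] is this equation solved for H'; the analytic content is in [is_derive_slope]. *)
Lemma slope_ode {s : R} : rho ^+ 2 < s ->
  (slope n psi rho s + 2 * s * slope' n psi rho s) * slope n psi rho s ^+ n.-1
  = psi ^+ n.
Proof.
move=> hs; have s0 := s_gt0 hs.
have H0 := slope_gt0 hs.
rewrite /slope' mulrDl -exprS prednK//.
set h := slope n psi rho s in H0 *.
have hn : h ^+ n.-1 != 0 by rewrite expf_neq0// gt_eqF.
rewrite invfM mulrCA -!mulrA mulrA.
rewrite [X in _ + X](_ : _ = psi ^+ n - h ^+ n); last first.
  by field; rewrite hn gt_eqF.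
by rewrite addrC subrK.
Qed.

Lemma is_derive_slope {s : R} : rho ^+ 2 < s ->
  is_derive s 1 (slope n psi rho) (slope' n psi rho s).
Proof.
move=> hs; have s0 := s_gt0 hs.
have dp := is_derive1_powR (- (n%:R / 2)) s0.
have dq := is_derive1_powR n%:R^-1 (W_gt0 hs).
have dW : is_derive s 1 W
   (rho ^+ n * (n%:R / 2 * s `^ (- (n%:R / 2) - 1))).
  apply: is_derive_eq.
  by rewrite -[_ *: _ in LHS]/(_ * _); ring.
have dc := is_derive1_comp dq dW.
have := @is_deriveZ _ _ _ _ psi _ _ _ dc.
rewrite -[X in is_derive _ _ X]/(slope n psi rho) => dH.
apply: is_derive_eq.
rewrite /slope' slope_expn// /slope -/(W s).
have Ws := W_gt0 hs; have w0 : 0 < W s `^ n%:R^-1 by rewrite powR_gt0.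
have Wn : W s = (W s `^ n%:R^-1) ^+ n.
  by rewrite powR_inv_exprn// ltW.
(* Splitting off the exponent -1 leaves only the powers W^(1/n) and s^(-n/2). *)
rewrite powRB ?(gt_eqF Ws) ?implybT// powRr1 ?ltW//.
rewrite powRB ?(gt_eqF s0) ?implybT// powRr1 ?ltW//.
have -> : psi ^+ n - psi ^+ n * W s = psi ^+ n * rho ^+ n * s `^ (- (n%:R / 2)).
  by rewrite /W; ring.
rewrite -[_ *: _ in LHS]/(_ * _).
(* Replacing [W s] by [w ^+ n] removes the remaining fractional exponents; once [n] is written as a
   successor, the goal is a rational identity. *)
set w := W s `^ n%:R^-1 in Wn w0 *; set p := s `^ _; rewrite Wn.
have nE : n = n.-1.+1 by rewrite prednK.
have nR : n%:R != 0 :> R by rewrite pnatr_eq0 -lt0n.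
move: nR; rewrite nE /= => nR.
rewrite !exprMn !(exprS _ n.-1).
have wm : w ^+ n.-1 != 0 by rewrite expf_neq0// gt_eqF.
have pm : psi ^+ n.-1 != 0 by rewrite expf_neq0// gt_eqF.
by field; rewrite wm pm !gt_eqF// addrC natr1.
Qed.

Lemma continuous_slope {s : R} : rho ^+ 2 < s ->
  {for s, continuous (slope n psi rho)}.
Proof. by move=> hs; exact/continuous_at_of_is_derive/is_derive_slope. Qed.

(** [slope'] is a rational expression in [s] and [slope], so continuity of [slope] suffices. *)
Lemma continuous_slope' {s : R} : rho ^+ 2 < s ->
  {for s, continuous (slope' n psi rho)}.
Proof.
move=> hs; have s0 := s_gt0 hs.
have cH := continuous_slope hs; have H0 := slope_gt0 hs.
have cHn m : {for s, continuous (fun t => slope n psi rho t ^+ m)}.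
  apply: (@continuous_comp _ _ _ (slope n psi rho) (fun t => t ^+ m)) => //.
  exact: exprn_continuous.
apply: continuousM; first by apply: continuousB => //; exact: cvg_cst.
apply: continuousV; first by rewrite !mulf_neq0 ?expf_neq0 ?gt_eqF.
apply: continuousM => //; apply: continuousM; [exact: cvg_cst|exact: cvg_id].
Qed.

End slope.

(** * From the profile to solutions on the annulus *)

Lemma is_derive_comp_sqr {R : realType} {F : R -> R} {dF r : R} :
  is_derive (r ^+ 2) 1 F dF -> is_derive r 1 (fun t => F (t ^+ 2)) (2 * r * dF).
Proof.
move=> dF'.
have ds : is_derive r 1 (fun t : R => t ^+ 2) (2 * r).
  by apply: is_derive_eq; rewrite -![_ *: _]/(_ * _); ring.
by rewrite mulrC; exact: (@is_derive1_comp _ F (fun t : R => t ^+ 2)).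
Qed.

(** With f(r) = F(r^2), one gets f' = r H(r^2) and f'' = H + 2 r^2 H', which turns the radial
    equation into the hypothesis on [H]. *)
Lemma radial_solution_sqnorm {R : realType} {n : nat} (Rm Rp psi s0 : R)
    (F H H' : R -> R) :
  0 < Rm -> s0 < Rm ^+ 2 ->
  (forall s, s0 < s -> is_derive s 1 F (H s / 2)) ->
  (forall s, s0 < s -> is_derive s 1 H (H' s)) ->
  (forall s, s0 < s -> (H s + 2 * s * H' s) * H s ^+ (n - 1) = psi ^+ n) ->
  radial_solution Rm Rp psi (F \o @sqnorm R n).
Proof.
move=> Rm0 s0R dF dH ode; exists (fun r => F (r ^+ 2)).
split=> [x _|r /andP[Rmr _]].
  by rewrite enorm_sqr.
have gt_s0 (t : R) : Rm < t -> s0 < t ^+ 2.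
  by move=> Rmt; rewrite (lt_trans s0R)// ltrXn2r// ltW// (lt_trans Rm0).
have r0 : 0 < r := lt_trans Rm0 Rmr.
have df t : Rm < t -> derive1 (fun r => F (r ^+ 2)) t = t * H (t ^+ 2).
  move=> Rmt; have [_] := is_derive_comp_sqr (dF _ (gt_s0 _ Rmt)).
  by rewrite derive1E => ->; field.
have ddf : is_derive r 1 (fun t => t * H (t ^+ 2))
    (H (r ^+ 2) + 2 * r ^+ 2 * H' (r ^+ 2)).
  have dh := is_derive_comp_sqr (dH _ (gt_s0 _ Rmr)).
  by apply: is_derive_eq; rewrite -![_ *: _]/(_ * _); ring.
have -> : derive1n 2 (fun r => F (r ^+ 2)) r =
    H (r ^+ 2) + 2 * r ^+ 2 * H' (r ^+ 2).
  rewrite derive1nS derive1n1 derive1E -(@derive_val _ _ _ _ _ _ _ ddf).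
  (* The formula for f' holds only for radii above [Rm], so it is substituted on a neighbourhood of
     [r]. *)
  by apply: near_eq_derive; near do apply: df; exact: lt_nbhsr.
by rewrite df// [r * _]mulrC mulfK ?gt_eqF// ode// gt_s0.
Unshelve. all: by end_near. Qed.

(** The family is parametrised by [e], the value of u_r / (psi r) at the inner radius, instead of
    rho; small [e] means rho close to [Rm]. *)
Lemma exists_radial_solution {R : realType} {n : nat} {Rm Rp psi e : R} :
  (0 < n)%N -> 0 < Rm -> Rm < Rp -> 0 < psi -> 0 < e < 1 ->
  exists u : 'rV[R]_n -> R,
    [/\ C2_up_to_boundary (annulus Rm Rp) u,
        radial_solution Rm Rp psi u,
        strictly_convex_on (annulus Rm Rp) u &
        forall x, boundary (eball Rm) x ->
          second_normal_derivative (annulus Rm Rp) u x = psi / e ^+ (n - 1)].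
Proof.
move=> n0 Rm0 RmRp psi0 /andP[e0 e1].
have en1 : 0 < 1 - e ^+ n by rewrite subr_gt0 exprn_ilt1 ?ltW// -?lt0n.
(* Chosen so that 1 - (rho / Rm)^n = e^n. *)
set rho := Rm * (1 - e ^+ n) `^ n%:R^-1.
have rho0 : 0 < rho by rewrite mulr_gt0// powR_gt0.
have rhon : rho ^+ n = Rm ^+ n * (1 - e ^+ n).
  rewrite exprMn; congr (_ * _).
  by rewrite powR_inv_exprn// ltW.
have rhoRm : rho ^+ 2 < Rm ^+ 2.
  rewrite ltrXn2r// ?(ltW rho0) ?(ltW Rm0)//.
  rewrite -(ltr_pXn2r n0) ?nnegrE ?(ltW rho0) ?(ltW Rm0)//.
  by rewrite rhon gtr_pMr ?exprn_gt0// gtrBl exprn_gt0.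
(* The midpoint leaves room on both sides: the integrand is continuous beyond the base point [s0] of
   the antiderivative, and the closed annulus lies strictly inside the region where [F] is
   differentiable. *)
pose s0 := (rho ^+ 2 + Rm ^+ 2) / 2.
have rhos0 : rho ^+ 2 < s0 by rewrite midf_lt.
have s0Rm : s0 < Rm ^+ 2 by rewrite midf_lt.
have gt_rho s : s0 < s -> rho ^+ 2 < s by exact: lt_trans.
pose H := slope n psi rho; pose H' := slope' n psi rho.
have [|F dF] := @antiderivative_ray R (fun s => H s / 2) _ _ rhos0.
  move=> s hs; apply: cvgM; last exact: cvg_cst.
  exact: continuous_slope.
have dH s : s0 < s -> is_derive s 1 H (H' s).
  by move=> /gt_rho; exact: is_derive_slope.
have cH' s : s0 < s -> {for s, continuous H'}.
  by move=> /gt_rho; exact: continuous_slope'.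
have ode s : s0 < s -> (H s + 2 * s * H' s) * H s ^+ (n - 1) = psi ^+ n.
  by move=> /gt_rho; rewrite subn1; exact: slope_ode.
have clU : closure (annulus Rm Rp) `<=` [set x : 'rV[R]_n | s0 < sqnorm x].
  move=> x /closure_annulus/= xRm; rewrite -enorm_sqr (lt_le_trans s0Rm)//.
  by rewrite lerXn2r ?nnegrE// ltW// (lt_le_trans Rm0).
have OU := subset_trans (@subset_closure _ _) clU.
(* Both sides are nonnegative, so it suffices to compare n-th powers, where the choice of [rho]
   applies. *)
have HRm : H (Rm ^+ 2) = psi * e.
  have H0 : 0 <= H (Rm ^+ 2) by rewrite ltW// slope_gt0.
  have pe0 : 0 <= psi * e by rewrite ltW// mulr_gt0.
  apply/eqP; rewrite -(eqrXn2 n0 H0 pe0); apply/eqP.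
  rewrite slope_expn// powR_half_sqr// rhon exprMn mulrAC divff ?mul1r.
    by rewrite opprB addrCA subrr addr0.
  by rewrite expf_neq0// gt_eqF.
exists (F \o sqnorm); split.
- exact: C2_radial clU.
- exact: radial_solution_sqnorm dF dH ode.
- move=> x /OU Ux; apply: (pos_def_hessian_radial dF dH) => //.
    exact/slope_gt0/gt_rho.
  exact/slope'_ge0/gt_rho.
- move=> x /boundary_eball xRm.
  have clx := inner_sphere_annulus Rm0 RmRp xRm.
  have q : sqnorm x = Rm ^+ 2 by rewrite -enorm_sqr xRm.
  have x0 : x != 0.
    have : 0 < sqnorm x by rewrite q exprn_gt0.
    apply: contraTneq.
    by move=> ->; rewrite /sqnorm big1 ?ltxx// => i _; rewrite mxE expr0n.
  have Ux := clU _ clx.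
  rewrite [LHS](second_normal_derivative_radial dF dH cH' _ OU clx Ux x0).
  have e_neq0 : e ^+ (n - 1) != 0 by rewrite expf_neq0// gt_eqF.
  have p_neq0 : psi ^+ (n - 1) != 0 by rewrite expf_neq0// gt_eqF.
  (* The differential equation at the inner radius reads u_nunu (psi e)^(n-1) = psi^n, from which
     the boundary value follows by division. *)
  have := ode _ s0Rm; rewrite q HRm exprMn => odeR.
  apply: (mulIf e_neq0); rewrite divfK//; apply: (mulIf p_neq0).
  rewrite -mulrA [e ^+ _ * _]mulrC odeR.
  by rewrite -exprS subn1 prednK.
Qed.

Theorem proposition2p17 (R : realType) (n : nat) (Rm Rp psi : R)
  (hn : (2 <= n)%N) (hRm : 0 < Rm) (hR : Rm < Rp) (hpsi : 0 < psi) :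
  exists u : nat -> 'rV[R]_n -> R,
    (forall k : nat,
      [/\ C2_up_to_boundary (annulus Rm Rp) (u k),
          radial_solution Rm Rp psi (u k)
        & strictly_convex_on (annulus Rm Rp) (u k)]) /\
    (forall M : R, \forall k \near \oo,
       forall x : 'rV[R]_n, boundary (eball Rm) x ->
         M < second_normal_derivative (annulus Rm Rp) (u k) x).
Proof.
(* The parameter is e = 1/(k+2); the shift by 2 keeps it strictly below 1 already at k = 0. *)
have eP k : 0 < (k.+2%:R : R)^-1 < 1.
  by rewrite invr_gt0 ltr0n/= invf_lt1 ?ltr0n// ltr1n.
have [u uP] := choice (fun k =>
  exists_radial_solution (ltnW hn) hRm hR hpsi (eP k)).
exists u; split=> [k|M]; first by have [] := uP k.
(* The second normal derivative is the constant psi (k+2)^(n-1) on the whole sphere, so one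
   threshold for [k] serves every [x]. *)
near=> k; move=> x xb; have [_ _ _ ->//] := uP k.
have kM : M / psi < k.+2%:R.
  rewrite (@lt_trans _ _ k%:R) ?ltr_nat//; near: k; exact: nbhs_infty_gtr.
rewrite exprVn invrK mulrC -ltr_pdivrMr// (lt_le_trans kM)//.
(* Here n >= 2 enters: the exponent n - 1 is positive, so (k+2)^(n-1) is at least k+2. *)
by rewrite ler_eXnr ?ler1n// subn_gt0.
Unshelve. all: by end_near. Qed.
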